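(* Let $G$ be a triangle-free graph of order $n$. Then $\phi(G)\le 6^{n/4}$. Furthermore, $\phi(G)=6^{n/4}$ if and only if $n\equiv 0\pmod 4$ and $G$ is isomorphic to the disjoint union of $n/4$ copies of the cycle $C_4$.
   Context: All graphs are finite, simple, undirected and labeled. A subset $F$ of vertices of a graph $G$ is a dissociation set if the induced subgraph $G[F]$ has maximum degree at most $1$. A maximal dissociation set is a dissociation set that is not a proper subset of any other dissociation set. $\phi(G)$ denotes the number of maximal dissociation sets of $G$. *)

(* Defs.v *)
From mathcomp Require Import all_boot all_order all_algebra.
From mathcomp Require Import all_classical all_reals all_analysis.
Set Implicit Arguments. Unset Strict Implicit. Unset Printing Implicit Defensive.

Definition simple_graph (T : finType) (e : rel T) : Prop :=
  symmetric e /\ irreflexive e.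

Definition triangle_free (T : finType) (e : rel T) : Prop :=
  forall x y z : T, ~ [&& e x y, e y z & e z x].

Definition dissociation (T : finType) (e : rel T) (F : {set T}) : bool :=
  [forall x in F, #|[set y in F | e x y]| <= 1].

Definition maximal_dissociation (T : finType) (e : rel T) (F : {set T}) : bool :=
  dissociation e F && [forall F' : {set T}, (F \proper F') ==> ~~ dissociation e F'].

Definition phi (T : finType) (e : rel T) : nat :=
  #|[set F : {set T} | maximal_dissociation e F]|.

Definition C4_rel : rel 'I_4 :=
  fun i j => ((i.+1 %% 4)%N == j) || ((j.+1 %% 4)%N == i).

Definition kC4_rel (k : nat) : rel ('I_k * 'I_4) :=
  fun u v => (u.1 == v.1) && C4_rel u.2 v.2.

Definition graph_iso (T1 T2 : finType) (e1 : rel T1) (e2 : rel T2) : Prop :=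
  exists f : T1 -> T2, bijective f /\ forall x y, e2 (f x) (f y) = e1 x y.

(* Main.v *)
(* Call [den S] the number of maximal dissociation sets of the subgraph induced on [S],
   divided by 6^(|S|/4).  If [C] is a union of components of G[F], then [F \ C] is a maximal
   dissociation set of the graph without the closed neighbourhood N[C], so the sets [F]
   containing [C] in this way contribute at most 6^(-|N[C]|/4) to [den S], by induction.
   Given a vertex [v] of minimum degree, every maximal dissociation set [F] has [v] as an
   isolated vertex, or an edge meeting N(v), or two isolated vertices in N(v).  In a
   triangle-free graph an edge uw dominates d(u) + d(w) vertices, and summing the
   contributions gives a total below 1 except in minimum degree 2, where only two
   configurations resist: a component C4, whose six pairs give exactly 1, and a path of
   five vertices of degree 2 centred at [v], where the leftover graphs have a vertex of
   degree at most 1 and therefore a density at most 6^(-2/4) + 2 * 6^(-3/4) < 1. *)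
Require Import Defs.
From mathcomp Require Import all_boot all_order all_algebra.
From mathcomp Require Import zify ring lra.
Set Implicit Arguments. Unset Strict Implicit. Unset Printing Implicit Defensive.
Import Order.TTheory GRing.Theory Num.Theory.

(** * Maximal dissociation sets of induced subgraphs *)

Section Dissociation.
Variables (T : finType) (e : rel T).
Implicit Types (S C F : {set T}) (u v w x y z : T).

Lemma dissociationP F :
  reflect {in F & &, forall x y z, e x y -> e x z -> y = z} (dissociation e F).
Proof.
apply: (iffP forall_inP) => [dF x y z xF yF zF xy xz|dF x xF].
  by apply/esym/(card_le1_eqP (dF x xF)); rewrite inE ?yF ?zF.
apply/card_le1_eqP => y z; rewrite !inE => /andP[yF xy] /andP[zF xz].
exact: dF xF _ _ xz xy.
Qed.

Lemma dissociationS F F' : F \subset F' -> dissociation e F' -> dissociation e F.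
Proof.
move=> /subsetP sF /dissociationP dF; apply/dissociationP => x y z xF yF zF.
by apply: dF; apply: sF.
Qed.

(** Maximality is tested by adding single vertices, which suffices because dissociation passes to
    subsets. *)
Definition maxdis S : {set {set T}} :=
  [set F : {set T} | [&& F \subset S, dissociation e F &
     [forall x in S :\: F, ~~ dissociation e (x |: F)]]].

Lemma maxdisP S F : reflect
  [/\ F \subset S, dissociation e F &
      forall x, x \in S -> x \notin F -> ~~ dissociation e (x |: F)]
  (F \in maxdis S).
Proof.
rewrite inE; apply: (iffP and3P) => -[sF dF mF]; split=> //.
  by move=> x xS xF; apply: (forall_inP mF); rewrite inE xF.
by apply/forall_inP => x; rewrite inE => /andP[xF xS]; apply: mF.
Qed.

Lemma phi_maxdis : phi e = #|maxdis [set: T]|.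
Proof.
apply: eq_card => F; rewrite !inE subsetT /=; congr (_ && _).
apply/forallP/forall_inP => [mF x|mF F'].
  by rewrite inE => /andP[xF _]; apply: (implyP (mF _)); rewrite properUr ?sub1set.
apply/implyP => /properP[/subsetP sF [x xF' xF]].
have /mF: x \in [set: T] :\: F by rewrite !inE xF.
apply: contra; apply: dissociationS; apply/subsetP => y.
by rewrite !inE => /predU1P[->|/sF].
Qed.

(** * Neighbourhoods, and dissociation sets from which a union of components is removed *)

Definition nb S u := [set y in S | e u y].
Definition deg S u := #|nb S u|.
(** Taken in the whole graph, whereas [nb] and [deg] are relative to [S]. *)
Definition cln C := C :|: [set y | [exists x in C, e x y]].

Lemma mem_nb S u y : (y \in nb S u) = (y \in S) && e u y.
Proof. by rewrite inE. Qed.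

Lemma nbS S S' u : S \subset S' -> nb S u \subset nb S' u.
Proof. by move=> /subsetP s; apply/subsetP => y; rewrite !mem_nb => /andP[/s->]. Qed.

Lemma sub_cln C : C \subset cln C. Proof. exact: subsetUl. Qed.

Lemma clnP C y : reflect (y \in C \/ exists2 x, x \in C & e x y) (y \in cln C).
Proof.
rewrite !inE; apply: (iffP orP) => -[yC|]; first by left.
- by case/exists_inP => x xC xy; right; exists x.
- by left.
- by case=> x xC xy; right; apply/exists_inP; exists x.
Qed.

(* The maximal dissociation sets of [S] in which [C] is a union of components. *)
Definition comp S C : {set {set T}} :=
  [set F in maxdis S | (C \subset F) && (F :&: cln C \subset C)].

Lemma compP S C F : reflect
  [/\ F \in maxdis S, C \subset F & forall x y, x \in C -> e x y -> y \in F -> y \in C]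
  (F \in comp S C).
Proof.
rewrite [F \in comp S C]in_set; apply: (iffP and3P) => -[mF sC nC]; split=> //.
- move=> x y xC xy yF; apply: (subsetP nC); rewrite inE yF.
  by apply/clnP; right; exists x.
- apply/subsetP => y; rewrite inE => /andP[yF /clnP[//|[x xC xy]]].
  exact: nC xy yF.
Qed.

Hypotheses (sym : symmetric e) (irr : irreflexive e).

(** Removing [C] is injective on sets containing [C]. The remainder is maximal outside the closed
    neighbourhood: a vertex [x] that could be added to it is not adjacent to [C], so it could be
    added to [F] as well. *)
Lemma leq_card_comp S C : #|comp S C| <= #|maxdis (S :\: cln C)|.
Proof.
rewrite -(@card_in_imset _ _ (fun F => F :\: C) (comp S C)); last first.
  move=> F F' /compP[_ sF _] /compP[_ sF' _] E.
  by rewrite -(setID F C) -(setID F' C) E (setIidPr sF) (setIidPr sF').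
apply/subset_leq_card/subsetP => _ /imsetP[F /compP[/maxdisP[sS dF mF] sC nC] ->].
have nC' x : x \in F -> x \notin C -> x \notin cln C.
  by move=> xF xC; apply/clnP => -[/(negP xC)//|[y yC yx]]; case/negP: xC; apply: nC yx _.
apply/maxdisP; split.
- by apply/subsetP => x /setDP[xF xC]; rewrite inE nC' // (subsetP sS).
- by apply: dissociationS dF; apply: subsetDl.
move=> x; rewrite !in_setD => /andP[xC xS].
have xnC : x \notin C by apply: contra xC; apply: (subsetP (sub_cln C)).
rewrite xnC /= => xF; apply: contra (mF x xS xF) => /dissociationP dx.
have xadj y : y \in C -> e y x = false.
  by move=> yC; apply: contraNF xC => yx; apply/clnP; right; exists y.
apply/dissociationP => y z t yF zF tF yz yt.
(* No edge joins [C] to [x] or to the rest of [F], so a vertex of [C] is handled by [dF], any other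
   vertex by [dx]. *)
case: (boolP (y \in C)) => yC.
  have mem s : e y s -> s \in x |: F -> s \in F.
    by move=> ys /setU1P[E|//]; rewrite E (xadj y) in ys.
  by apply: (dissociationP _ dF y z t) => //; [exact: (subsetP sC)|exact: mem|exact: mem].
have mem s : e y s -> s \in x |: F -> s \in x |: (F :\: C).
  move=> ys /setU1P[->|sF]; rewrite !inE ?eqxx // sF andbT orbC.
  apply/orP; left; apply/negP => sCs; case/setU1P: yF => [E|yF].
    by rewrite sym E (xadj s) in ys.
  by case/negP: yC; apply: (nC s) yF => //; rewrite sym.
apply: (dx y z t) => //; try exact: mem.
by move: yF; rewrite !inE yC.
Qed.

(** * Covering the maximal dissociation sets around a vertex *)

(** An edge of [F] meeting N(v), in particular an edge at [v], is a component of [F]. Without such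
    an edge, [v] and its neighbours are isolated whenever they lie in [F]; and if [v] is not in [F],
    then two of its neighbours are, since otherwise [v] could be added. *)
Lemma maxdis_cover S v F : v \in S -> F \in maxdis S ->
  [\/ F \in comp S [set v],
      exists u w, [/\ u \in nb S v, w \in nb S u & F \in comp S [set u; w]] |
      exists2 B : {set T}, B \in [set B : {set T} | B \subset nb S v & #|B| == 2] &
              F \in comp S B].
Proof.
move=> vS FM; have /maxdisP[sF dF mF] := FM.
have dF' := dissociationP _ dF.
have FS := subsetP sF.
have edge u w : u \in F -> w \in F -> e u w -> F \in comp S [set u; w].
  move=> uF wF uw; apply/compP; split=> //.
    by apply/subsetP => z /set2P[]->.
  move=> z y /set2P[]-> zy yF; rewrite !inE.
    by rewrite (dF' u w y) // eqxx orbT.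
  by rewrite (dF' w u y) ?eqxx // sym.
case: (boolP [exists u in F, [exists w in F, e v u && e u w]]) => [|noedge].
  case/exists_inP => u uF /exists_inP[w wF /andP[vu uw]].
  apply: Or32; exists u, w; split; rewrite ?mem_nb ?FS //.
  exact: edge.
case: (boolP (v \in F)) => vF.
  apply: Or31; apply/compP; split; rewrite ?sub1set // => x y /set1P -> vy yF.
  case/negP: noedge; apply/exists_inP; exists y => //.
  by apply/exists_inP; exists v => //; rewrite vy sym.
apply: Or33.
case: (boolP [exists u in F, [exists w in F, [&& e v u, e v w & u != w]]]) => [|nopair].
  case/exists_inP => u uF /exists_inP[w wF /and3P[vu vw uw]].
  exists [set u; w].
    rewrite inE cards2 uw eqxx andbT; apply/subsetP => z /set2P[]->;
    by rewrite mem_nb ?vu ?vw FS.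
  apply/compP; split=> //; first by apply/subsetP => z /set2P[]->.
  move=> z y zB zy yF; case/negP: noedge; apply/exists_inP; exists z.
    by case/set2P: zB => ->.
  by apply/exists_inP; exists y => //; rewrite zy andbT; case/set2P: zB => ->.
case/negP: (mF v vS vF); apply/dissociationP.
have nE u w : u \in F -> w \in F -> e v u -> e u w -> False.
  move=> uF wF vu uw; case/negP: noedge; apply/exists_inP; exists u => //.
  by apply/exists_inP; exists w; rewrite ?vu.
have nP u w : u \in F -> w \in F -> e v u -> e v w -> u = w.
  move=> uF wF vu vw; apply/eqP/negP => /negP uw; case/negP: nopair.
  by apply/exists_inP; exists u => //; apply/exists_inP; exists w; rewrite ?vu ?vw.
move=> x y z /setU1P[->|xF] /setU1P[->|yF] /setU1P[->|zF]; rewrite ?irr //.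
- by move=> ??; apply: nP.
- by move=> xv xz; case: (nE x z) => //; rewrite sym.
- by move=> xy xv; case: (nE x y) => //; rewrite sym.
- exact: dF'.
Qed.

Lemma leq_card_bigcup (I : finType) (P : pred I) (D : I -> {set {set T}}) :
  #|\bigcup_(i | P i) D i| <= \sum_(i | P i) #|D i|.
Proof.
elim/big_rec2: _ => [|i m A _ lem]; first by rewrite cards0.
by rewrite (leq_trans (leq_card_setU _ _)) // leq_add2l.
Qed.

(** The last term stays the cardinal of a union: with twins in N(v), different pairs give the same
    sets, and a sum would count these repeatedly. *)
Lemma leq_card_cover S v : v \in S ->
  #|maxdis S| <= #|comp S [set v]|
    + \sum_(u in nb S v) \sum_(w in nb S u) #|comp S [set u; w]|
    + #|\bigcup_(B in [set B : {set T} | B \subset nb S v & #|B| == 2]) comp S B|.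
Proof.
move=> vS.
pose E := \bigcup_(u in nb S v) \bigcup_(w in nb S u) comp S [set u; w].
apply: (@leq_trans #|comp S [set v] :|: E :|:
   \bigcup_(B in [set B : {set T} | B \subset nb S v & #|B| == 2]) comp S B|).
  apply/subset_leq_card/subsetP => F /(maxdis_cover vS)[FC|[u [w [uN wN FC]]]|[B BN FC]].
  - by rewrite !in_setU FC.
  - rewrite in_setU [in X in X || _]in_setU.
    suff -> : F \in E by rewrite orbT.
    by apply/bigcupP; exists u => //; apply/bigcupP; exists w.
  - by rewrite in_setU orbC; apply/orP; left; apply/bigcupP; exists B.
apply: leq_trans (leq_card_setU _ _) _; rewrite leq_add2r.
apply: leq_trans (leq_card_setU _ _) _; rewrite leq_add2l.
apply: leq_trans (leq_card_bigcup _ _) _.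
by apply: leq_sum => u _; apply: leq_card_bigcup.
Qed.

(** All neighbours of [u] in [F] lie in [C], where [u] has none. *)
Lemma comp_sub S C u : u \in C -> {in C, forall w, ~~ e u w} ->
  comp S C \subset comp S [set u].
Proof.
move=> uC nC; apply/subsetP => F /compP[FM sC nF]; apply/compP; split=> //.
  by rewrite sub1set (subsetP sC).
by move=> x y /set1P -> uy yF; case/negP: (nC y (nF u y uC uy yF)).
Qed.

(** If [u] is isolated in [F], its twin [w] has no neighbour in [F] either, so maximality forces [w]
    into [F]. *)
Lemma comp_twin S u w : u \in S -> w \in S -> nb S u = nb S w ->
  comp S [set u] \subset comp S [set u; w].
Proof.
move=> uS wS E; apply/subsetP => F /compP[FM uF nF].
have /maxdisP[sF dF mF] := FM; rewrite sub1set in uF.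
have nu y : y \in F -> e u y = false.
  move=> yF; apply/negP => uy; have /set1P E' := nF u y (set11 u) uy yF.
  by rewrite E' irr in uy.
have nw y : y \in F -> e w y = false.
  move=> yF; have := nu y yF; have := subsetP sF y yF.
  by move/setP/(_ y): E; rewrite !mem_nb => + yS; rewrite yS /= => ->.
have wF : w \in F.
  apply/negPn/negP => wF; case/negP: (mF w wS wF); apply/dissociationP.
  move=> x y z /setU1P[->|xF] /setU1P[->|yF] /setU1P[->|zF]; rewrite ?irr ?nw //.
  - by rewrite sym nw.
  - by rewrite (sym x w) nw.
  - by apply: (dissociationP _ dF).
apply/compP; split=> //; first by apply/subsetP => z /set2P[]->.
by move=> x y /set2P[]-> xy yF; rewrite ?nu ?nw in xy.
Qed.

(** * Numbers of dominated vertices in a triangle-free graph *)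

Hypothesis (tf : triangle_free e).

Lemma no_triangle x y z : e x y -> e x z -> e y z = false.
Proof. by move=> xy xz; apply/negP => yz; apply: (tf (x := x) (y := y) (z := z)); rewrite xy yz sym xz. Qed.

Lemma leq_deg_cln S v : v \in S -> deg S v + 1 <= #|S :&: cln [set v]|.
Proof.
move=> vS; have vN : v \notin nb S v by rewrite mem_nb irr andbF.
rewrite addnC -[1 + _]/(true + #|nb S v|) -vN -cardsU1; apply/subset_leq_card/subsetP => y.
rewrite in_setU1 in_setI mem_nb => /predU1P[->|/andP[yS vy]].
  by rewrite vS (subsetP (sub_cln _)) ?set11.
by rewrite yS; apply/clnP; right; exists v; rewrite ?set11.
Qed.

(** The neighbourhoods of adjacent vertices are disjoint, as a common element would close a
    triangle. *)
Lemma leq_edge_cln S u w : w \in nb S u -> deg S u + deg S w <= #|S :&: cln [set u; w]|.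
Proof.
rewrite mem_nb => /andP[wS uw]; rewrite -cardsUI.
have -> : nb S u :&: nb S w = set0.
  apply/setP => y; rewrite in_setI !mem_nb inE; apply/negP => /and3P[/andP[_ uy] _ wy].
  by rewrite (no_triangle uw uy) in wy.
rewrite cards0 addn0; apply/subset_leq_card/subsetP => y.
rewrite in_setU in_setI !mem_nb => /orP[] /andP[-> ay]; apply/clnP; right.
  by exists u; rewrite ?set21.
by exists w; rewrite ?set22.
Qed.

(** The common neighbour [v] keeps [a] and [b] non-adjacent, so both count in addition to their
    neighbourhoods. *)
Lemma leq_pair_cln S v a b : a \in nb S v -> b \in nb S v -> a != b ->
  #|nb S a :|: nb S b| + 2 <= #|S :&: cln [set a; b]|.
Proof.
rewrite !mem_nb => /andP[aS va] /andP[bS vb] ab.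
have -> : 2 = #|[set a; b]| by rewrite cards2 ab.
rewrite -cardsUI; have -> : (nb S a :|: nb S b) :&: [set a; b] = set0; last first.
  rewrite cards0 addn0; apply/subset_leq_card/subsetP => y.
  rewrite [in X in X -> _]in_setU [in X in X -> _]in_setU in_setI !mem_nb.
  case: (boolP (y \in [set a; b])) => [yB _|_].
    by rewrite (subsetP (sub_cln _)) //; case/set2P: yB => ->; rewrite ?aS ?bS.
  rewrite orbF => /orP[] /andP[-> ay]; apply/clnP; right.
    by exists a; rewrite ?set21.
  by exists b; rewrite ?set22.
apply/setP => y; rewrite in_setI in_setU !mem_nb in_set0.
apply/negP => /andP[yN /set2P[E|E]]; move: yN; rewrite E irr.
  by rewrite (no_triangle vb va) !andbF.
by rewrite (no_triangle va vb) !andbF.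
Qed.

Lemma nb_sym S u w : u \in S -> w \in nb S u -> u \in nb S w.
Proof. by move=> uS; rewrite !mem_nb => /andP[_ uw]; rewrite uS sym. Qed.

Local Open Scope ring_scope.

(** * Numerical estimates for the fourth root of 1/6 *)

Section Density.
Variables (R : realFieldType) (x : R).
Hypotheses (x_gt0 : 0 < x) (x4 : x ^+ 4 = 6^-1).

(** The value is about 0.6389; this precision suffices for all the cases below. *)
Let x_le : x <= 639 / 1000.
Proof.
rewrite leNgt; apply/negP => lt_x.
have : (639 / 1000) ^+ 4 < x ^+ 4 by rewrite ltrXn2r ?(ltW x_gt0) //; lra.
by rewrite x4; lra.
Qed.

Let x_ge : 638 / 1000 <= x.
Proof.
rewrite leNgt; apply/negP => lt_x.
have : x ^+ 4 < (638 / 1000) ^+ 4 by rewrite ltrXn2r ?(ltW x_gt0) //; lra.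
by rewrite x4; lra.
Qed.

Let xn_le n : x ^+ n <= (639 / 1000) ^+ n.
Proof. by rewrite lerXn2r ?nnegrE ?(ltW x_gt0) //; lra. Qed.
Let x2_le : x ^+ 2 <= 409 / 1000. Proof. by have := xn_le 2; lra. Qed.
Let x3_le : x ^+ 3 <= 262 / 1000. Proof. by have := xn_le 3; lra. Qed.
Let x5E : x ^+ 5 = x / 6. Proof. by rewrite exprS x4. Qed.
Let x6E : x ^+ 6 = x ^+ 2 / 6. Proof. by rewrite (exprD x 2 4) x4. Qed.
Let xn_ge0 n : 0 <= x ^+ n. Proof. exact: exprn_ge0 (ltW x_gt0). Qed.
Let xn_anti m n : (m <= n)%N -> x ^+ n <= x ^+ m.
Proof. by move=> mn; apply: ler_wiXn2l => //; [exact: ltW|have := x_le; lra]. Qed.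

(** An edge dominating d(u) + d(w) vertices contributes at most [x^(d(u)+d(w))], so sums over
    neighbours produce factors [d * x^d]. *)
Definition wdeg (d : nat) : R := d%:R * x ^+ d.

Lemma wdeg_ge0 d : 0 <= wdeg d. Proof. by rewrite mulr_ge0. Qed.

(** Consecutive values have ratio [x (d+1)/d], at most [3x/2 < 1] once [d >= 2]. *)
Lemma wdeg_anti k d : (2 <= k)%N -> (k <= d)%N -> wdeg d <= wdeg k.
Proof.
move=> k2; elim: d => [|d IHd]; first by case: k k2.
rewrite leq_eqVlt => /predU1P[->//|]; rewrite ltnS => kd.
apply: le_trans (IHd kd); rewrite /wdeg exprS mulrA ler_wpM2r //.
have : 2 <= d%:R :> R by rewrite ler_nat (leq_trans k2).
by rewrite -natr1; have := x_le; nra.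
Qed.

Lemma wdeg_le2 d : (0 < d)%N -> wdeg d <= wdeg 2.
Proof.
case: d => [//|[|d]] _; last exact: wdeg_anti.
by rewrite /wdeg expr1 expr2; have := x_ge; have := x_gt0; nra.
Qed.

(** The maximum is at [d = 5], with value [10x/6]; from there on the ratio [x (d+1)/(d-1)] is at
    most [3x/2 < 1]. *)
Lemma bin2_le d : (4 <= d)%N -> 'C(d, 2)%:R * x ^+ d <= 107 / 100.
Proof.
case: d => [//|d]; rewrite ltnS leq_eqVlt => /predU1P[<-|].
  by rewrite x4 (_ : 'C(4, 2) = 6)%N //; lra.
elim: d => [//|d IHd]; rewrite ltnS leq_eqVlt => /predU1P[<-|d4].
  by rewrite x5E (_ : 'C(5, 2) = 10)%N //; have := x_le; lra.
apply: le_trans (IHd d4); rewrite exprS mulrA ler_wpM2r //.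
have E n : 'C(n.+1, 2)%:R = (n%:R + 1) * n%:R / 2 :> R.
  have -> : (n%:R + 1) * n%:R = ('C(n.+1, 2) * 2)%:R :> R.
    rewrite natr1 -natrM; congr _%:R.
    by rewrite [RHS]mulnC -(mul_bin_diag n.+1 1) bin1.
  by rewrite natrM; field.
rewrite !E; have : 4 <= d%:R :> R by rewrite ler_nat.
by rewrite -natr1; have := x_le; nra.
Qed.

(* With [x = 6^(-1/4)], the bound to be proved reads [den S <= 1]. *)
Definition den S : R := #|maxdis S|%:R * x ^+ #|S|.
Definition rho S C : R := #|comp S C|%:R * x ^+ #|S|.
(** The induction hypothesis for [S]. *)
Definition bounded S := forall S', S' \proper S -> den S' <= 1.

(** * Bounds for the contributions to the density *)

Lemma den_ge0 S : 0 <= den S. Proof. by rewrite mulr_ge0. Qed.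

Lemma rho_sub S C C' : comp S C \subset comp S C' -> rho S C <= rho S C'.
Proof. by move=> sC; rewrite ler_wpM2r // ler_nat subset_leq_card. Qed.

(** Every vertex of [S] dominated by [C] yields a factor [x]. *)
Lemma rho_den S C : rho S C <= den (S :\: cln C) * x ^+ #|S :&: cln C|.
Proof.
rewrite /den -mulrA -exprD [(#|_ :\: _| + _)%N]addnC cardsID ler_wpM2r //.
by rewrite ler_nat leq_card_comp.
Qed.

Lemma properD_cln S C k : (k < #|S :&: cln C|)%N -> S :\: cln C \proper S.
Proof.
by move=> k0; rewrite properEcard subsetDl -[#|S|](cardsID (cln C) S) -addn1 addnC leq_add2r (leq_ltn_trans _ k0).
Qed.

Lemma rho_le S C k : bounded S -> (0 < k)%N -> (k <= #|S :&: cln C|)%N -> rho S C <= x ^+ k.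
Proof.
move=> bS k0 kC; apply: le_trans (rho_den S C) _.
apply: le_trans (xn_anti kC); rewrite ler_piMl // bS //.
by apply: (@properD_cln _ _ 0%N); apply: leq_trans kC.
Qed.

Definition pairs S v := [set B : {set T} | B \subset nb S v & #|B| == 2%N].
Definition rhop S v : R := #|\bigcup_(B in pairs S v) comp S B|%:R * x ^+ #|S|.
Definition rhoe S u : R := \sum_(w in nb S u) rho S [set u; w].

Lemma den_cover S v : v \in S ->
  den S <= rho S [set v] + \sum_(u in nb S v) rhoe S u + rhop S v.
Proof.
move=> vS; rewrite (eq_bigr (fun u =>
  (\sum_(w in nb S u) #|comp S [set u; w]|)%:R * x ^+ #|S|)); last first.
  by move=> u _; rewrite natr_sum mulr_suml.
rewrite /den /rhop /rho -mulr_suml -natr_sum -!mulrDl -!natrD ler_wpM2r // ler_nat.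
exact: leq_card_cover.
Qed.

Lemma rhop_le S v c : (forall B, B \in pairs S v -> rho S B <= c) ->
  rhop S v <= 'C(deg S v, 2)%:R * c.
Proof.
move=> le_c; rewrite /deg -cards_draws mulr_natl -sumr_const.
apply: le_trans (ler_sum _ le_c); rewrite -mulr_suml -natr_sum ler_wpM2r // ler_nat.
exact: leq_card_bigcup.
Qed.

Lemma rhoe_le S u k : bounded S -> u \in S -> (0 < k)%N ->
  (forall w, w \in nb S u -> (k <= deg S w)%N) -> rhoe S u <= x ^+ k * wdeg (deg S u).
Proof.
move=> bS uS k0 dk; rewrite /wdeg mulrCA -exprD mulr_natl -sumr_const.
apply: ler_sum => w wN; apply: rho_le => //; first by rewrite addn_gt0 k0.
by apply: leq_trans (leq_edge_cln wN); rewrite addnC leq_add2l dk.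
Qed.

(** One neighbour of degree at least 3 improves one of the [deg S u] terms from exponent
    [deg S u + 2] to [deg S u + 3]. *)
Lemma rhoe_le_big S u w : bounded S -> u \in S -> w \in nb S u ->
  (forall z, z \in nb S u -> (2 <= deg S z)%N) -> (3 <= deg S w)%N ->
  rhoe S u <= (deg S u)%:R * x ^+ (deg S u + 2) - x ^+ (deg S u + 2) + x ^+ (deg S u + 3).
Proof.
move=> bS uS wN d2 d3; rewrite /rhoe (big_setD1 w) //= addrC lerD //; last first.
  by apply: (rho_le bS); [rewrite addn_gt0 orbT|apply: leq_trans (leq_edge_cln wN); rewrite leq_add2l].
rewrite /deg (cardsD1 w (nb S u)) wN /= natrD mulrDl mul1r addrAC subrr add0r mulr_natl -sumr_const.
apply: ler_sum => z /setD1P[_ zN].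
apply: (rho_le bS); first by rewrite addn_gt0 orbT.
by apply: leq_trans (leq_edge_cln zN); rewrite /deg (cardsD1 w (nb S u)) wN leq_add2l d2.
Qed.

Lemma rho1_le S v : bounded S -> v \in S -> rho S [set v] <= x ^+ (deg S v + 1).
Proof. by move=> bS vS; apply: rho_le; rewrite ?leq_deg_cln // addn1. Qed.

Lemma rho_pair_le S v a b k : bounded S -> a \in nb S v -> b \in nb S v -> a != b ->
  (k <= #|nb S a :|: nb S b|)%N -> rho S [set a; b] <= x ^+ (k + 2).
Proof.
move=> bS aN bN ab kU; apply: rho_le => //; first by rewrite addn2.
by apply: leq_trans (leq_pair_cln aN bN ab); rewrite leq_add2r.
Qed.

(** * A vertex of degree at most 1 *)

Definition low : R := x ^+ 2 + 2 * x ^+ 3.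

(** There are no pairs in N(v). If [u] is the only neighbour of [v], then [v] isolated gives [x^2],
    and the edges at [u] give at most [x * wdeg 2 = 2x^3]. If [v] has no neighbour, the total is at
    most [x], which is smaller than [low]. *)
Lemma den_low S v : bounded S -> v \in S -> (deg S v <= 1)%N -> den S <= low.
Proof.
move=> bS vS d1; apply: le_trans (den_cover vS) _.
have -> : rhop S v = 0.
  rewrite /rhop big1 ?cards0 ?mul0r // => B; rewrite inE => /andP[/subset_leq_card sB /eqP B2].
  by move: (leq_trans sB d1); rewrite B2.
rewrite addr0 /low; have := rho1_le bS vS; move: d1.
rewrite leq_eqVlt ltnS leqn0 => /orP[/cards1P[u Eu]|/eqP d0].
  rewrite {1}/deg Eu cards1 big_set1 => r1; apply: lerD => //.
  have uN : u \in nb S v by rewrite Eu set11.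
  have uS : u \in S by move: uN; rewrite mem_nb => /andP[].
  have vN := nb_sym vS uN.
  apply: le_trans (rhoe_le (k := 1) bS uS _ _) _ => //.
    by move=> w wN; apply/card_gt0P; exists u; apply: nb_sym.
  rewrite expr1 (exprS x 2) [2 * _]mulrCA ler_pM2l //; apply: wdeg_le2.
  by apply/card_gt0P; exists v.
rewrite d0 add0n expr1 (cards0_eq d0) big_set0 addr0 => r1.
apply: le_trans r1 _; rewrite -[x in X in X <= _]mulr1.
by have := x_ge; have := x_gt0; rewrite !exprS expr0; nra.
Qed.

Lemma bounded_sub S S' : bounded S -> S' \subset S -> bounded S'.
Proof. by move=> bS sS S2 pS; apply: bS; apply: proper_sub_trans sS. Qed.

(** Removing [t] leaves [z] with degree at most 1, so [den_low] improves the bound 1 on the density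
    of the remaining graph. *)
Lemma rho_low S C z t k : bounded S -> z \in S -> z \notin cln C -> t \in S -> t \in cln C ->
  e z t -> (deg S z <= 2)%N -> (k <= #|S :&: cln C|)%N -> rho S C <= low * x ^+ k.
Proof.
move=> bS zS zC tS tC zt d2 kC; apply: le_trans (rho_den S C) _.
apply: ler_pM => //; first exact: den_ge0; last exact: xn_anti.
apply: (@den_low _ z); first by apply: bounded_sub bS _; apply: subsetDl.
  by rewrite in_setD zC.
rewrite -ltnS; apply: leq_trans d2; apply/proper_card/properP; split.
  exact: nbS (subsetDl _ _).
by exists t; rewrite mem_nb ?tS // in_setD tC.
Qed.


(** * Minimum degree at least 3 *)

Lemma nb_sub S v u : u \in nb S v -> u \in S.
Proof. by rewrite mem_nb => /andP[]. Qed.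

Lemma pairsP S v B : B \in pairs S v ->
  exists a b, [/\ a \in nb S v, b \in nb S v, a != b & B = [set a; b]].
Proof.
rewrite inE => /andP[/subsetP sB /cards2P[a [b [ab EB]]]].
by exists a, b; split=> //; apply: sB; rewrite EB ?set21 ?set22.
Qed.

Lemma rhoe_min S v : bounded S -> v \in S -> (2 <= deg S v)%N ->
  (forall u, u \in S -> (deg S v <= deg S u)%N) ->
  \sum_(u in nb S v) rhoe S u <= wdeg (deg S v) * wdeg (deg S v).
Proof.
move=> bS vS d2 dmin; rewrite {1}/wdeg -mulrA mulr_natl -sumr_const.
apply: ler_sum => u uN; have uS := nb_sub uN.
apply: le_trans (rhoe_le (k := deg S v) bS uS _ _) _; first exact: ltnW.
  by move=> w /nb_sub; apply: dmin.
by apply: ler_wpM2l => //; apply: wdeg_anti => //; apply: dmin.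
Qed.

(** A pair in N(v) dominates at least [deg S v + 2] vertices. The three contributions are at most
    [x/6], [4/9] and [1.07 * 0.409], in total about 0.99. *)
Lemma den_deg_ge4 S v : bounded S -> v \in S -> (4 <= deg S v)%N ->
  (forall u, u \in S -> (deg S v <= deg S u)%N) -> den S < 1.
Proof.
move=> bS vS d4 dmin; apply: le_lt_trans (den_cover vS) _.
have r1 : rho S [set v] <= x / 6.
  by rewrite -x5E; apply: le_trans (rho1_le bS vS) _; apply: xn_anti; rewrite addn1.
have r2 := rhoe_min bS vS (leq_trans (isT : 2 <= 4)%N d4) dmin.
have h4 : wdeg (deg S v) <= 4 / 6 by apply: le_trans (wdeg_anti _ d4) _ => //; rewrite /wdeg x4.
have r3 : rhop S v <= 'C(deg S v, 2)%:R * x ^+ deg S v * x ^+ 2.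
  rewrite -mulrA -exprD; apply: rhop_le => B /pairsP[a [b [aN bN ab ->]]].
  apply: (rho_pair_le bS aN bN ab).
  apply: leq_trans (dmin _ (nb_sub aN)) _; apply: subset_leq_card; exact: subsetUl.
have r4 : 'C(deg S v, 2)%:R * x ^+ deg S v * x ^+ 2 <= 107 / 100 * (409 / 1000).
  by apply: ler_pM => //; [rewrite mulr_ge0|apply: bin2_le].
have r5 : wdeg (deg S v) * wdeg (deg S v) <= 4 / 6 * (4 / 6) by apply: ler_pM => //; apply: wdeg_ge0.
by have := x_le; lra.
Qed.

(** The contributions are at most [x^4], [9x^6] and [3x^6], with sum [1/6 + 2x^2], about 0.983. *)
Lemma den_deg3 S v : bounded S -> v \in S -> deg S v = 3%N ->
  (forall u, u \in S -> (deg S v <= deg S u)%N) -> den S < 1.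
Proof.
move=> bS vS d3 dmin; apply: le_lt_trans (den_cover vS) _.
have r1 : rho S [set v] <= 1 / 6 by have := rho1_le bS vS; rewrite d3 x4; lra.
have r2 : \sum_(u in nb S v) rhoe S u <= 9 * (409 / 1000 / 6).
  apply: le_trans (rhoe_min bS vS _ dmin) _; rewrite d3 // /wdeg.
  rewrite (_ : 3%:R * x ^+ 3 * (3%:R * x ^+ 3) = 9 * x ^+ 6); last by ring.
  by rewrite x6E; have := x2_le; lra.
suff r3 : rhop S v <= 3 * (409 / 1000 / 6) by lra.
have nadj a b : a \in nb S v -> b \in nb S v -> ~~ e a b.
  by rewrite !mem_nb => /andP[_ va] /andP[_ vb]; rewrite (no_triangle va vb).
(* If two neighbours of [v] are twins, sets with two isolated neighbours of [v]
   contain both twins; otherwise every such pair dominates six vertices. *)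
case: (boolP [exists a in nb S v, [exists b in nb S v, (a != b) && (nb S a == nb S b)]]).
  case/exists_inP => a aN /exists_inP[b bN /andP[ab /eqP Eab]].
  have sB B : B \in pairs S v -> comp S B \subset comp S [set a; b].
    rewrite inE => /andP[/subsetP sBN /eqP B2].
    have nB c : c \in B -> {in B, forall d, ~~ e c d}.
      by move=> cB d dB; apply: nadj; apply: sBN.
    case: (boolP (a \in B)) => aB.
      apply: subset_trans (comp_sub S aB (nB a aB)) _.
      by apply: comp_twin => //; apply: nb_sub; eassumption.
    case: (boolP (b \in B)) => bB.
      apply: subset_trans (comp_sub S bB (nB b bB)) _; rewrite setUC.
      by apply: comp_twin => //; apply: nb_sub; eassumption.
    (* A pair avoiding both twins would have to fit into the one remaining neighbour of [v]. *)
    have : (#|B| <= #|nb S v :\ a :\ b|)%N.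
      apply/subset_leq_card/subsetP => z zB; rewrite !in_setD1 sBN // andbT.
      by apply/andP; split; [apply: contraNneq bB => <-|apply: contraNneq aB => <-].
    move: (cardsD1 a (nb S v)) (cardsD1 b (nb S v :\ a)).
    rewrite -/(deg S v) d3 aN in_setD1 bN eq_sym ab B2 /=; clear; lia.
  have : rhop S v <= rho S [set a; b].
    rewrite /rhop /rho ler_wpM2r // ler_nat; apply: subset_leq_card.
    by apply/bigcupsP => B; apply: sB.
  move/le_trans; apply.
  apply: le_trans (rho_pair_le (k := 3) bS aN bN ab _) _.
    apply: leq_trans (subset_leq_card (subsetUl _ _)).
    by rewrite -d3; apply: dmin; apply: nb_sub aN.
  by rewrite x5E; have := x_le; lra.
move=> ntwin; apply: le_trans (rhop_le (c := x ^+ 6) _) _; last first.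
  by rewrite d3 (_ : 'C(3, 2) = 3)%N // x6E; have := x2_le; lra.
move=> B /pairsP[a [b [aN bN ab ->]]]; apply: (rho_pair_le (k := 4) bS aN bN ab).
(* Each neighbourhood has at least three elements, so a union of at most three equals both and makes
   [a] and [b] twins. *)
rewrite ltnNge; apply/negP => U3; case/negP: ntwin.
apply/exists_inP; exists a => //; apply/exists_inP; exists b => //; rewrite ab /=.
have /eqP -> : nb S a == nb S a :|: nb S b.
  rewrite eqEcard subsetUl; apply: leq_trans U3 _.
  by rewrite -d3; apply: dmin; apply: nb_sub aN.
rewrite eq_sym eqEcard subsetUr; apply: leq_trans U3 _.
by rewrite -d3; apply: dmin; apply: nb_sub bN.
Qed.

(** * Minimum degree 2 *)

(** Prescribing all four neighbourhoods in [S] makes the cycle [v], [a], [w], [b] a component of the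
    graph on [S]. *)
Definition isC4 S v a w b := [/\ v != w, a != b, v \in S /\ w \in S,
  nb S v = [set a; b] /\ nb S w = [set a; b] &
  nb S a = [set v; w] /\ nb S b = [set v; w]].

Lemma bigcup_deg2 S v a b : nb S v = [set a; b] -> a != b ->
  \bigcup_(B in pairs S v) comp S B \subset comp S [set a; b].
Proof.
move=> Ev ab; apply/bigcupsP => B; rewrite inE Ev => /andP[sB B2].
suff -> : B = [set a; b] by [].
by apply/eqP; rewrite eqEcard sB (eqP B2) cards2 ab.
Qed.

Lemma rhop_deg2 S v a b : nb S v = [set a; b] -> a != b -> rhop S v <= rho S [set a; b].
Proof.
by move=> Ev ab; rewrite ler_wpM2r // ler_nat; apply/subset_leq_card/bigcup_deg2.
Qed.

Lemma nb_deg2 S u v : deg S u = 2%N -> v \in nb S u -> exists2 w, w != v & nb S u = [set v; w].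
Proof.
move=> /eqP; rewrite /deg => /cards2P[a [b [ab ->]]] /set2P[]->.
  by exists b; rewrite // eq_sym.
by exists a; rewrite // setUC.
Qed.

(** The crude bound [x^3 + 4x^4 + x^5] exceeds 1. After [v] or the edge [vb] is taken, [w] survives
    without its neighbour [a]; after the edge [va], [y] survives without [b]. So three terms gain a
    factor [low], and the total drops below 1. *)
Lemma den_path S v a b w y : bounded S -> v \in S -> a != b ->
  nb S v = [set a; b] -> nb S a = [set v; w] -> nb S b = [set v; y] ->
  w != v -> y != v -> w != y -> deg S w = 2%N -> deg S y = 2%N -> den S < 1.
Proof.
move=> bS vS ab Ev Ea Eb wv yv wy dw dy; apply: le_lt_trans (den_cover vS) _.
have aN : a \in nb S v by rewrite Ev set21.
have bN : b \in nb S v by rewrite Ev set22.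
have wN : w \in nb S a by rewrite Ea set22.
have yN : y \in nb S b by rewrite Eb set22.
have [aS bS' wS yS] : [/\ a \in S, b \in S, w \in S & y \in S].
  by split; apply: nb_sub; eassumption.
have va : e v a by move: aN; rewrite mem_nb => /andP[].
have vb : e v b by move: bN; rewrite mem_nb => /andP[].
have aw : e a w by move: wN; rewrite mem_nb => /andP[].
have by_ : e b y by move: yN; rewrite mem_nb => /andP[].
have eE s t : t \in S -> e s t = (t \in nb S s) by move=> tS; rewrite mem_nb tS.
have [av bv] : a != v /\ b != v.
  by split; [apply: contraTneq va => ->|apply: contraTneq vb => ->]; rewrite irr.
have [wa yb] : w != a /\ y != b.
  by split; [apply: contraTneq aw => ->|apply: contraTneq by_ => ->]; rewrite irr.
have aEb : e a b = false by rewrite (no_triangle va vb).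
have wb : w != b by apply: contraTneq aw => ->; rewrite aEb.
have ya : y != a by apply: contraTneq by_ => ->; rewrite sym aEb.
have aEy : e a y = false by rewrite eE // Ea !inE (negbTE yv) eq_sym (negbTE wy).
have bEw : e b w = false by rewrite eE // Eb !inE (negbTE wv) (negbTE wy).
have vEw : e v w = false by rewrite eE // Ev !inE (negbTE wa) (negbTE wb).
have vEy : e v y = false by rewrite eE // Ev !inE (negbTE ya) (negbTE yb).
have dv : deg S v = 2%N by rewrite /deg Ev cards2 ab.
have da : deg S a = 2%N by rewrite /deg Ea cards2 eq_sym wv.
have db : deg S b = 2%N by rewrite /deg Eb cards2 eq_sym yv.
have clE s C : (s \in cln C) = (s \in C) || [exists t in C, e t s] by rewrite in_setU inE.
have edge s t k : t \in nb S s -> k = (deg S s + deg S t)%N -> (k <= #|S :&: cln [set s; t]|)%N.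
  by move=> tN ->; apply: leq_edge_cln.
have r1 : rho S [set v] <= low * x ^+ 3.
  apply: (rho_low (z := w) (t := a)) => //; last 1 first.
  - by have := leq_deg_cln vS; rewrite dv.
  - apply/negP => /clnP[/set1P E|[s /set1P -> /negP]]; first by rewrite E eqxx in wv.
    by rewrite vEw.
  - by apply/clnP; right; exists v; rewrite ?set11.
  - by rewrite sym.
  - by rewrite dw.
have vNa : v \in nb S a by rewrite Ea set21.
have vNb : v \in nb S b by rewrite Eb set21.
have ra : rhoe S a <= low * x ^+ 4 + x ^+ 4.
  rewrite /rhoe Ea big_setU1 /= ?big_set1; last by rewrite inE eq_sym.
  apply: lerD; last by apply: rho_le => //; apply: edge; rewrite ?da ?dw.
  apply: (rho_low (z := y) (t := b)) => //; last 1 first.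
  - by apply: edge; rewrite ?da ?dv.
  - apply/negP => /clnP[/set2P[]E|[s /set2P[]-> /negP]]; rewrite ?vEy ?aEy //.
      by rewrite E eqxx in ya.
    by rewrite E eqxx in yv.
  - by apply/clnP; right; exists v; rewrite ?set22.
  - by rewrite sym.
  - by rewrite dy.
have rb : rhoe S b <= low * x ^+ 4 + x ^+ 4.
  rewrite /rhoe Eb big_setU1 /= ?big_set1; last by rewrite inE eq_sym.
  apply: lerD; last by apply: rho_le => //; apply: edge; rewrite ?db ?dy.
  apply: (rho_low (z := w) (t := a)) => //; last 1 first.
  - by apply: edge; rewrite ?db ?dv.
  - apply/negP => /clnP[/set2P[]E|[s /set2P[]-> /negP]]; rewrite ?vEw ?bEw //.
      by rewrite E eqxx in wb.
    by rewrite E eqxx in wv.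
  - by apply/clnP; right; exists v; rewrite ?set22.
  - by rewrite sym.
  - by rewrite dw.
have rp : rhop S v <= x ^+ 5.
  apply: le_trans (rhop_deg2 Ev ab) _; apply: (rho_pair_le (k := 3) bS aN bN ab).
  have -> : 3%N = #|[set v; w; y]|.
    by rewrite setUC cardsU1 cards2 !inE (eq_sym v) wv negb_or yv eq_sym wy.
  apply/subset_leq_card/subsetP => t; rewrite Ea Eb !inE => /orP[/orP[]|] ->; by rewrite ?orbT.
rewrite Ev big_setU1 /= ?big_set1; last by rewrite inE.
have lE : low <= 933 / 1000 by rewrite /low; have := x2_le; have := x3_le; lra.
have lx : low * x ^+ 3 <= 933 / 1000 * (262 / 1000).
  apply: ler_pM => //; by rewrite /low addr_ge0 ?xn_ge0 // mulr_ge0 ?xn_ge0.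
by rewrite x4 in ra rb; rewrite x5E in rp; have := x_le; lra.
Qed.

(** The cases follow the degrees of the two neighbours [a] and [b]: one at least 4; both at most 3
    with sum at least 5; both equal to 2. In the last case their other neighbours coincide or end a
    path of five vertices. *)
Lemma den_deg2 S v : bounded S -> v \in S -> deg S v = 2%N ->
  (forall u, u \in S -> (deg S v <= deg S u)%N) ->
  den S < 1 \/ exists a w b, isC4 S v a w b.
Proof.
move=> bS vS dv dmin; have [a [b [ab Ev]]] : exists a b, a != b /\ nb S v = [set a; b].
  by move/eqP: (dv) => /cards2P.
have d2 u : u \in S -> (2 <= deg S u)%N by rewrite -dv; apply: dmin.
have aN : a \in nb S v by rewrite Ev set21.
have bN : b \in nb S v by rewrite Ev set22.
have aS := nb_sub aN; have bS' := nb_sub bN.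
have vNa := nb_sym vS aN; have vNb := nb_sym vS bN.
have cov := den_cover vS; rewrite Ev big_setU1 ?inE //= big_set1 in cov.
have rp := rhop_deg2 Ev ab.
have r1 : rho S [set v] <= x ^+ 3 by have := rho1_le bS vS; rewrite dv.
have re u : u \in S -> rhoe S u <= x ^+ 2 * wdeg (deg S u).
  by move=> uS; apply: rhoe_le => // w /nb_sub /d2.
have rebig u w : u \in S -> w \in nb S u -> (3 <= deg S w)%N ->
    rhoe S u <= (deg S u)%:R * x ^+ (deg S u + 2) - x ^+ (deg S u + 2) + x ^+ (deg S u + 3).
  by move=> uS wN dw; apply: (rhoe_le_big bS uS wN _ dw) => z /nb_sub; apply: d2.
have ra := re a aS; have rb := re b bS'.
have rU k : (k <= #|nb S a :|: nb S b|)%N -> rhop S v <= x ^+ (k + 2).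
  by move=> kU; apply: le_trans rp _; apply: (rho_pair_le bS aN bN ab kU).
have Ua : (deg S a <= #|nb S a :|: nb S b|)%N by apply: subset_leq_card; apply: subsetUl.
have Ub : (deg S b <= #|nb S a :|: nb S b|)%N by apply: subset_leq_card; apply: subsetUr.
have h2 : wdeg 2 = 2 * x ^+ 2 by [].
have h3 : wdeg 3 = 3 * x ^+ 3 by [].
have h4 : wdeg 4 = 4 / 6 by rewrite /wdeg x4.
have hx2 : x ^+ 2 * wdeg 2 = 2 / 6 by rewrite h2 mulrCA -exprD x4.
have hx3 : x ^+ 2 * wdeg 3 = 3 * (x / 6) by rewrite h3 mulrCA -exprD x5E.
have hx k u : u \in S -> (2 <= k)%N -> (k <= deg S u)%N -> x ^+ 2 * wdeg (deg S u) <= x ^+ 2 * wdeg k.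
  by move=> uS k2 kd; apply: ler_wpM2l => //; apply: wdeg_anti.
have [[xl x2l] x3l] := (x_le, x2_le, x3_le).
have big4 u t : u \in S -> t \in S -> (4 <= deg S u)%N -> (deg S u <= #|nb S a :|: nb S b|)%N ->
    rho S [set v] + (x ^+ 2 * wdeg (deg S u) + x ^+ 2 * wdeg (deg S t)) + rhop S v < 1.
  move=> uS tS du Uu; have := hx 4 u uS isT du; have := hx 2 t tS isT (d2 t tS).
  have := rU 4 (leq_trans du Uu); rewrite x6E hx2 h4.
  lra.
case: (leqP 4 (deg S a)) => [a4|a3]; first by left; have := big4 a b aS bS' a4 Ua; lra.
case: (leqP 4 (deg S b)) => [b4|b3]; first by left; have := big4 b a bS' aS b4 Ub; lra.
have da : deg S a = 2%N \/ deg S a = 3%N by move: (d2 a aS) a3; clear; lia.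
have db : deg S b = 2%N \/ deg S b = 3%N by move: (d2 b bS') b3; clear; lia.
have UI := cardsUI (nb S a) (nb S b); rewrite -/(deg S a) -/(deg S b) in UI.
(* A second common neighbour [w] either has large degree or is a twin of [v]. *)
have common w : w \in nb S a -> w \in nb S b -> w != v ->
    (3 <= deg S w)%N \/ [/\ rho S [set v] <= x ^+ 4, nb S w = [set a; b] & w \in S].
  move=> wa wb wv; have wS := nb_sub wa.
  case: (leqP 3 (deg S w)) => [|dw]; [by left|right].
  have Ew : nb S w = [set a; b].
    apply/esym/eqP; rewrite eqEcard; apply/andP; split; last by rewrite cards2 ab.
    apply/subsetP => z /set2P[]->.
      exact: nb_sym wa.
    exact: nb_sym wb.
  (* A set with [v] isolated also contains its twin [w], and together they dominate four vertices
     instead of three. *)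
  split=> //; have tw := comp_twin vS wS (etrans Ev (esym Ew)).
  apply: le_trans (rho_sub tw) _; apply: rho_le => //.
  have -> : 4%N = #|[set v; w; a; b]|.
    rewrite -setUA cardsU cards2 cards2 ab eq_sym wv.
    suff -> : [set v; w] :&: [set a; b] = set0 by rewrite cards0.
    apply/setP => z; rewrite in_setI in_set0; apply/negP => /andP[/set2P[]->].
      by rewrite -Ev mem_nb irr andbF.
    by rewrite -Ew mem_nb irr andbF.
  apply/subset_leq_card/subsetP => z; rewrite -setUA => /setUP[zvw|zab]; rewrite in_setI.
    by rewrite (subsetP (sub_cln _)) // andbT; case/set2P: zvw => ->.
  rewrite -Ev in zab; rewrite (nb_sub zab); apply/clnP; right; exists v; first exact: set21.
  by move: zab; rewrite mem_nb => /andP[].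
have getcommon : (2 <= #|nb S a :&: nb S b|)%N ->
    exists w, [/\ w \in nb S a, w \in nb S b & w != v].
  move=> I2; have : (0 < #|(nb S a :&: nb S b) :\ v|)%N.
    by move: (cardsD1 v (nb S a :&: nb S b)); rewrite in_setI vNa vNb; move: I2; clear; lia.
  by case/card_gt0P => w; rewrite in_setD1 in_setI => /and3P[wv wa wb]; exists w.
have main34 : (4 <= #|nb S a :|: nb S b|)%N -> rhoe S a + rhoe S b <= 2 / 6 + 3 * (x / 6) ->
    den S < 1.
  by move/rU; rewrite x6E => *; lra.
have main33 : (#|nb S a :|: nb S b| <= 3)%N -> (5 <= deg S a + deg S b)%N ->
    (3 <= #|nb S a :|: nb S b|)%N ->
    rhoe S a + rhoe S b <= 2 / 6 + 3 * (x / 6) -> den S < 1.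
  move=> U3 ab5 /rU; rewrite x5E => rU3 rab.
  have [|w [wa wb wv]] := getcommon; first by move: U3 ab5 UI; clear; lia.
  have [dw|[rv _ _]] := common w wa wb wv; last by rewrite x4 in rv; lra.
  (* The bound 0.282 covers both [x^4 + x^5] (degree 2) and [2x^5 + x^6] (degree 3). *)
  have rbig u : u \in S -> (deg S u = 2%N \/ deg S u = 3%N) -> w \in nb S u ->
      rhoe S u <= 282 / 1000.
    move=> uS du wu; have := rebig u w uS wu dw.
    by case: du => ->; rewrite ?x4 x5E ?x6E; lra.
  have := rbig a aS da wa; have := rbig b bS' db wb; lra.
case: (leqP 5 (deg S a + deg S b)) => [ab5|ab4].
  left; have rab : rhoe S a + rhoe S b <= 2 / 6 + 3 * (x / 6).
    have := ra; have := rb.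
    case: da => da; case: db => db; rewrite da db ?hx2 ?hx3; try lra.
    by rewrite da db in ab5.
  case: (leqP #|nb S a :|: nb S b| 3) => [U3|U4]; last exact: main34.
  apply: main33 => //; move: da db Ua Ub ab5; clear; lia.
have {da}da : deg S a = 2%N by move: da db ab4; clear; lia.
have {db}db : deg S b = 2%N by move: da db ab4; clear; lia.
have [w wv Ea] := nb_deg2 da vNa; have [y yv Eb] := nb_deg2 db vNb.
have wa : w \in nb S a by rewrite Ea set22.
have yb : y \in nb S b by rewrite Eb set22.
have big u z : u \in S -> deg S u = 2%N -> z \in nb S u -> (3 <= deg S z)%N ->
    rhoe S u <= 1 / 6 + x / 6.
  by move=> uS du zu dz; have := rebig u z uS zu dz; rewrite du x4 x5E; lra.
rewrite da hx2 in ra; rewrite db hx2 in rb.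
have [E|wy] := eqVneq w y.
  (* Here [v], [a], [w], [b] form a 4-cycle; it is a component unless [w] has further neighbours. *)
  subst y; have [dw|[_ Ew wS]] := common w wa yb wv.
    left; have := big a w aS da wa dw; have := big b w bS' db yb dw.
    have := rU 2%N; rewrite -{1}da x4 => /(_ Ua) *; lra.
  by right; exists a, w, b; split=> //; rewrite eq_sym.
left; have /rU : (3 <= #|nb S a :|: nb S b|)%N.
  have -> : 3%N = #|[set v; w; y]|.
    by rewrite setUC cardsU1 cards2 !inE (eq_sym v) wv negb_or yv eq_sym wy.
  apply/subset_leq_card/subsetP => t; rewrite Ea Eb !inE => /orP[/orP[]|] ->; by rewrite ?orbT.
rewrite x5E => r3.
case: (leqP 3 (deg S w)) => [dw|dw]; first by have := big a w aS da wa dw; lra.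
case: (leqP 3 (deg S y)) => [dy|dy]; first by have := big b y bS' db yb dy; lra.
have {dw}dw : deg S w = 2%N by move: dw (d2 w (nb_sub wa)); clear; lia.
have {dy}dy : deg S y = 2%N by move: dy (d2 y (nb_sub yb)); clear; lia.
exact: (den_path bS vS ab Ev Ea Eb).
Qed.


(** * Splitting off 4-cycles, and the induction *)

Lemma isC4_sub S v a w b : isC4 S v a w b -> [set v; a; w; b] \subset S.
Proof.
move=> [_ _ [vS wS] [Ev _] _]; apply/subsetP => z; rewrite !inE -!orbA.
by case/or4P=> /eqP-> //; apply: (@nb_sub _ v); rewrite Ev ?set21 ?set22.
Qed.

Lemma isC4_uniq S v a w b : isC4 S v a w b -> uniq [:: v; a; w; b].
Proof.
move=> [vw ab _ [Ev Ew] _] /=.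
have [aN bN] : a \in nb S v /\ b \in nb S v by rewrite Ev set21 set22.
have [aW bW] : a \in nb S w /\ b \in nb S w by rewrite Ew set21 set22.
have [va vb wa wb] : [/\ v != a, v != b, w != a & w != b].
  by split; apply/eqP => E; [move: aN|move: bN|move: aW|move: bW]; rewrite mem_nb E irr andbF.
by rewrite !inE !negb_or va vw vb ab eq_sym wa wb.
Qed.

Lemma isC4_card S v a w b : isC4 S v a w b -> #|[set v; a; w; b]| = 4%N.
Proof.
move/isC4_uniq/card_uniqP => E; rewrite -[RHS]/(size [:: v; a; w; b]) -E.
apply: eq_card => z.
by rewrite !inE -!orbA.
Qed.

(** Since [v] and [w] are twins, the cover consists of the four edges and the two diagonals, and
    each of these six pairs dominates exactly the cycle. *)
Lemma leq_maxdis_C4 S v a w b : isC4 S v a w b ->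
  (#|maxdis S| <= 6 * #|maxdis (S :\: [set v; a; w; b])|)%N.
Proof.
move=> [vw ab [vS wS] [Ev Ew] [Ea Eb]].
have clE p q : S :\: cln [set p; q] = S :\: ([set p; q] :|: nb S p :|: nb S q).
  apply/setP => z; rewrite !in_setD; case: (boolP (z \in S)) => zS; rewrite ?andbF // !andbT.
  congr (~~ _); rewrite -setUA; apply/clnP/setUP => -[zB|]; try by left.
    case=> y /set2P[]-> yz; right; first by rewrite in_setU mem_nb zS yz.
    by rewrite in_setU !mem_nb zS yz orbT.
  rewrite in_setU !mem_nb zS /= => /orP[pz|qz]; right; first by exists p; rewrite ?set21.
  by exists q; rewrite ?set22.
have le p q : [set p; q] :|: nb S p :|: nb S q = [set v; a; w; b] ->
    (#|comp S [set p; q]| <= #|maxdis (S :\: [set v; a; w; b])|)%N.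
  by move=> E; rewrite -E -clE; apply: leq_card_comp.
apply: leq_trans (leq_card_cover vS) _.
rewrite Ev big_setU1 ?inE //= big_set1 Ea Eb !big_setU1 ?inE //= !big_set1.
have c1 := subset_leq_card (comp_twin vS wS (etrans Ev (esym Ew))).
have := subset_leq_card (bigcup_deg2 Ev ab); rewrite /pairs Ev => c2.
have l1 : (#|comp S [set v; w]| <= #|maxdis (S :\: [set v; a; w; b])|)%N.
  apply: le; rewrite Ev Ew; apply/setP => z; rewrite !inE.
  by case: (z == v); case: (z == a); case: (z == w); case: (z == b).
have l2 p q : p \in [set a; b] -> q \in [set v; w] ->
    (#|comp S [set p; q]| <= #|maxdis (S :\: [set v; a; w; b])|)%N.
  move=> pab qvw; apply: le.
  have -> : nb S p = [set v; w] by case/set2P: pab => ->.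
  have -> : nb S q = [set a; b] by case/set2P: qvw => ->.
  move: pab qvw => /set2P[]-> /set2P[]->; apply/setP => z; rewrite !inE;
  by case: (z == v); case: (z == a); case: (z == w); case: (z == b).
have l3 : (#|comp S [set a; b]| <= #|maxdis (S :\: [set v; a; w; b])|)%N.
  apply: le; rewrite Ea Eb; apply/setP => z; rewrite !inE.
  by case: (z == v); case: (z == a); case: (z == w); case: (z == b).
move: (l2 a v) (l2 a w) (l2 b v) (l2 b w) c1 c2 l1 l3; rewrite !inE !eqxx !orbT /=.
move=> /(_ isT isT) A /(_ isT isT) B /(_ isT isT) C /(_ isT isT) D.
by move: A B C D; clear; lia.
Qed.

Inductive C4dec : {set T} -> Prop :=
| C4dec0 : C4dec set0
| C4decU S v a w b : isC4 S v a w b -> C4dec (S :\: [set v; a; w; b]) -> C4dec S.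

Lemma den_step S : bounded S -> S != set0 ->
  den S < 1 \/ exists v a w b, isC4 S v a w b.
Proof.
move=> bS /set0Pn[v0 v0S].
case: (arg_minnP (deg S) v0S) => v vS dmin.
case: (ltngtP (deg S v) 2) => [d1|d3|d2].
- left; apply: le_lt_trans (den_low bS vS d1) _; rewrite /low.
  by have := x2_le; have := x3_le; lra.
- left; move: d3; rewrite leq_eqVlt => /predU1P[d3|d4]; last exact: den_deg_ge4 bS vS d4 dmin.
  exact: den_deg3 bS vS (esym d3) dmin.
- by case: (den_deg2 bS vS d2 dmin) => [|[a [w [b]]]]; [left|right; exists v, a, w, b].
Qed.

Lemma den_le1 S : den S <= 1 /\ (den S = 1 -> C4dec S).
Proof.
have [n] := ubnP #|S|; elim: n S => // n IHn S; rewrite ltnS => Sn.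
have bS : bounded S.
  by move=> S' /proper_card S'S; apply: (proj1 (IHn _ _)); apply: leq_trans Sn.
have [->|S0] := eqVneq S set0.
  split=> [|_]; last exact: C4dec0.
  rewrite /den cards0 expr0 mulr1 lern1.
  rewrite -(cards1 (set0 : {set T})); apply/subset_leq_card/subsetP => F /maxdisP[].
  by rewrite subset0 inE.
have [lt1|[v [a [w [b C4]]]]] := den_step bS S0.
  by split=> [|E]; [apply: ltW|rewrite E ltxx in lt1].
have C4c := isC4_card C4; have C4S := isC4_sub C4.
have SE : #|S| = (#|S :\: [set v; a; w; b]| + 4)%N.
  by rewrite -C4c addnC -(cardsID [set v; a; w; b] S) (setIidPr C4S).
(* The factor 6 is cancelled by [x^4 = 1/6]; hence density 1 is inherited by the rest of the
   graph. *)
have le : den S <= den (S :\: [set v; a; w; b]).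
  rewrite /den SE exprD x4.
  have := leq_maxdis_C4 C4; rewrite -(ler_nat R) natrM => leM.
  have := ler_wpM2r (xn_ge0 #|S :\: [set v; a; w; b]|) leM; lra.
have [|le1 eq1] := IHn (S :\: [set v; a; w; b]).
  by rewrite SE in Sn; move: Sn; clear; lia.
split=> [|E]; first exact: le_trans le1.
by apply: C4decU C4 _; apply: eq1; apply/eqP; rewrite eq_le le1 -E.
Qed.

End Density.

(** * From the decomposition to an isomorphism *)

(** Here [f] numbers the copies and [g] gives the position on the cycle. Natural numbers as values
    of [f] let the labelling be extended cycle by cycle, the new cycle receiving the number [k]. *)
Lemma C4dec_labelling S : C4dec S ->
  exists k (f : T -> nat) (g : T -> 'I_4),
  [/\ #|S| = (4 * k)%N, {in S, forall y, (f y < k)%N},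
      {in S &, forall y z, f y = f z -> g y = g z -> y = z} &
      {in S &, forall y z, e y z = (f y == f z) && C4_rel (g y) (g z)}].
Proof.
elim=> [|{}S v a w b C4 _ [k [f [g [Sk fk fg_inj eE]]]]].
  by exists 0%N, (fun=> 0%N), (fun=> ord0); split=> [|y|y|y]; rewrite ?cards0 ?inE.
have C4c := isC4_card C4; have C4S := isC4_sub C4; set C := [set v; a; w; b] in C4c C4S *.
pose g' y : 'I_4 := if y == v then inord 0 else if y == a then inord 1
  else if y == w then inord 2 else if y == b then inord 3 else g y.
exists k.+1, (fun y => if y \in C then k else f y), g'.
have Sk' : #|S| = (4 * k.+1)%N by rewrite -(cardsID C S) (setIidPr C4S) C4c Sk mulnS.
have U := isC4_uniq C4.
have [vw ab [vS wS] [Ev Ew] [Ea Eb]] := C4.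
have /and4P[] := U; rewrite !inE !negb_or => /and3P[va _ vb] /andP[aw _] wb _.
have gv : g' v = inord 0 by rewrite /g' eqxx.
have ga : g' a = inord 1 by rewrite /g' eqxx eq_sym (negbTE va).
have gw : g' w = inord 2 by rewrite /g' eqxx eq_sym (negbTE vw) eq_sym (negbTE aw).
have gb : g' b = inord 3.
  by rewrite /g' eqxx eq_sym (negbTE vb) eq_sym (negbTE ab) eq_sym (negbTE wb).
have CP y : y \in C -> [\/ y = v, y = a, y = w | y = b].
  by rewrite !inE -!orbA => /or4P[]/eqP; [constructor 1|constructor 2|constructor 3|constructor 4].
have gS y : y \notin C -> g' y = g y.
  by rewrite /g' !inE -!orbA => /norP[/negbTE-> /norP[/negbTE-> /norP[/negbTE-> /negbTE->]]].
have CS y : y \in C -> y \in S by apply: (subsetP C4S).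
have nbC y z : y \in C -> z \in S -> e y z = (z \in nb S y) by move=> _ zS; rewrite mem_nb zS.
have cross y z : y \in C -> z \in S -> z \notin C -> e y z = false.
  move=> yC zS zC; rewrite nbC //; apply: contraNF zC.
  by case: (CP y yC) => ->; rewrite ?Ev ?Ea ?Ew ?Eb !inE => /orP[] ->; rewrite ?orbT.
have fk' y : y \in S -> y \notin C -> (f y < k)%N by move=> yS yC; apply: fk; rewrite inE yC.
split=> [//|y yS|y z yS zS|y z yS zS].
- by case: ifPn => // yC; apply: leqW; apply: fk'.
- case: ifPn => yC; case: ifPn => zC.
  + move=> _; case: (CP y yC) => ->; case: (CP z zC) => ->; rewrite ?gv ?ga ?gw ?gb //;
    by move/(congr1 val); rewrite /= !inordK.
  + by move=> E; have := fk' z zS zC; rewrite -E ltnn.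
  + by move=> E; have := fk' y yS yC; rewrite E ltnn.
  + by rewrite !gS //; apply: fg_inj; rewrite inE ?yC ?zC.
- case: ifPn => yC; case: ifPn => zC.
  + rewrite eqxx nbC //= /C4_rel.
    have nsym (s t : T) : s != t -> (t == s) = false by rewrite eq_sym => /negbTE.
    have neq := (negbTE va, negbTE vw, negbTE vb, negbTE aw, negbTE ab, negbTE wb,
      nsym _ _ va, nsym _ _ vw, nsym _ _ vb, nsym _ _ aw, nsym _ _ ab, nsym _ _ wb).
    by case: (CP y yC) => ->; case: (CP z zC) => ->; rewrite ?Ev ?Ea ?Ew ?Eb ?gv ?ga ?gw ?gb;
      rewrite !inordK // !in_set2 !neq ?eqxx.
  + by rewrite cross //; apply/esym/negbTE; rewrite negb_and gtn_eqF ?fk'.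
  + by rewrite sym cross //; apply/esym/negbTE; rewrite negb_and ltn_eqF ?fk'.
  + by rewrite !gS // eE // inE ?yC ?zC.
Qed.

Lemma C4dec_iso : C4dec [set: T] ->
  (4 %| #|T|)%N /\ graph_iso e (@kC4_rel (#|T| %/ 4)).
Proof.
case/C4dec_labelling => k [f [g [Tk fk fg_inj eE]]].
rewrite cardsT in Tk; rewrite Tk dvdn_mulr // mulKn //; split=> //.
pose F y : 'I_k * 'I_4 := (Ordinal (fk y (in_setT y)), g y).
exists F; split.
  apply: inj_card_bij; last by rewrite card_prod !card_ord Tk mulnC.
  by move=> y z [Ef Eg]; apply: fg_inj; rewrite ?inE.
by move=> y z; rewrite eE ?inE.
Qed.

End Dissociation.

(** * The lower bound for disjoint 4-cycles *)

Lemma C4_relxx (i : 'I_4) : C4_rel i i = false.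
Proof. by case: i => [[|[|[|[|]]]]]. Qed.

(** Deleting one vertex of a 4-cycle leaves a path, whose middle vertex sees both others; thus a
    dissociation set has at most two vertices in each copy. *)
Lemma C4_three (i j k : 'I_4) : i != j -> i != k -> j != k ->
  [|| C4_rel i j && C4_rel i k, C4_rel j i && C4_rel j k | C4_rel k i && C4_rel k j].
Proof.
by case: i => [[|[|[|[|//]]]] ?]; case: j => [[|[|[|[|//]]]] ?]; case: k => [[|[|[|[|//]]]] ?].
Qed.

(** Each choice of two of the four vertices in every copy is a maximal dissociation set, and there
    are [6^k] choices. *)
Lemma leq_phi_kC4 (T : finType) (e : rel T) k :
  graph_iso e (@kC4_rel k) -> 6 ^ k <= phi e.
Proof.
case=> f [[g fK gK] fe].
pose P2 := [set A : {set 'I_4} | #|A| == 2].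
pose F (c : {ffun 'I_k -> {set 'I_4}}) := [set y | (f y).2 \in c (f y).1].
have F_inj : injective F.
  move=> c c' E; apply/ffunP => i; apply/setP => j.
  by have := congr1 (fun A : {set T} => g (i, j) \in A) E; rewrite !inE gK.
have <- : #|(ffun_on P2 : {pred {ffun 'I_k -> {set 'I_4}}})| = 6 ^ k.
  by rewrite card_ffun_on card_draws !card_ord.
rewrite -(card_imset _ F_inj); apply/subset_leq_card/subsetP => _ /imsetP[c /ffun_onP cP ->].
have c2 i : #|c i| = 2 by have := cP i; rewrite inE => /eqP.
rewrite inE /maximal_dissociation; apply/andP; split.
  apply/dissociationP => y z t; rewrite !inE => yF zF tF; rewrite -!fe /kC4_rel.
  move=> /andP[/eqP Ez yz] /andP[/eqP Et yt].
  apply: (can_inj fK); rewrite [f z]surjective_pairing [f t]surjective_pairing -Ez -Et.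
  congr pair; rewrite -Ez in zF; rewrite -Et in tF.
  have /card_le1_eqP cle : #|c (f y).1 :\ (f y).2| <= 1.
    by rewrite -(leq_add2l ((f y).2 \in c (f y).1)) -cardsD1 c2 yF.
  apply/esym/cle; rewrite in_setD1 ?zF ?tF andbT.
    by apply: contraTneq yz => ->; rewrite C4_relxx.
  by apply: contraTneq yt => ->; rewrite C4_relxx.
apply/forallP => F'; apply/implyP => /properP[/subsetP sF [y yF' yF]].
apply/negP => /dissociationP dF'.
move: yF; rewrite inE => yF.
(* An added vertex [y] would be the third one in its copy. *)
have /eqP/cards2P[p [q [pq Epq]]] := c2 (f y).1.
have mem r : r \in [set p; q] -> g ((f y).1, r) \in F'.
  by move=> rpq; apply: sF; rewrite inE gK /= Epq.
have [pF qF] := (mem p (set21 p q), mem q (set22 p q)).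
move: yF; rewrite Epq !inE negb_or => /andP[yp yq].
have adj r s : C4_rel r s -> e (g ((f y).1, r)) (g ((f y).1, s)).
  by move=> rs; rewrite -fe !gK /kC4_rel /= eqxx.
have yE : y = g ((f y).1, (f y).2) by rewrite -surjective_pairing fK.
have yF2 : g ((f y).1, (f y).2) \in F' by rewrite -yE.
have g_inj r s : g ((f y).1, r) = g ((f y).1, s) -> r = s.
  by move/(can_inj gK) => -[].
case/or3P: (C4_three yp yq pq) => /andP[/adj h1 /adj h2].
- by move: pq; rewrite (g_inj _ _ (dF' _ _ _ yF2 pF qF h1 h2)) eqxx.
- by move: yq; rewrite (g_inj _ _ (dF' _ _ _ pF yF2 qF h1 h2)) eqxx.
- by move: yp; rewrite (g_inj _ _ (dF' _ _ _ qF yF2 pF h1 h2)) eqxx.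
Qed.

(* Imported this late because the notations of classical sets hide those of [finset]. *)
From mathcomp Require Import all_classical all_reals all_analysis.
Local Open Scope ring_scope.

Theorem theorem1p2 (R : realType) (T : finType) (e : rel T) :
  simple_graph e -> triangle_free e ->
  ((phi e)%:R <= (6 : R) `^ (#|T|%:R / 4))%R /\
  ((phi e)%:R = (6 : R) `^ (#|T|%:R / 4) <->
     ((4 %| #|T|)%N /\ graph_iso e (@kC4_rel (#|T| %/ 4)))).
Proof.
move=> [sym irr] tf.
(* With [a] the fourth root of 6, the real power becomes [a ^+ #|T|], and the density is used with
   [x = a^-1]. *)
pose a : R := 6 `^ (4^-1).
have a0 : 0 < a by apply: powR_gt0; rewrite ltr0n.
have a4 : a ^+ 4 = 6 by rewrite -powR_mulrn ?(ltW a0) // -powRrM mulVf // powRr1.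
have -> : (6 : R) `^ (#|T|%:R / 4) = a ^+ #|T|.
  by rewrite -powR_mulrn ?(ltW a0) // -powRrM mulrC.
have x0 : 0 < a^-1 by rewrite invr_gt0.
have x4 : a^-1 ^+ 4 = 6^-1 by rewrite exprVn a4.
have denE : den e a^-1 [set: T] = (phi e)%:R / a ^+ #|T|.
  by rewrite /den -phi_maxdis cardsT exprVn.
have an0 : 0 < a ^+ #|T| by apply: exprn_gt0.
have [le1 eq1] := den_le1 sym irr tf x0 x4 [set: T].
have le : (phi e)%:R <= a ^+ #|T| by rewrite denE ler_pdivrMr // mul1r in le1.
split=> //; split=> [E|[/divnK dT iso]].
  by apply: C4dec_iso => //; apply: eq1; rewrite denE E divff // gt_eqF.
(* As 4 divides the order, the bound is an integral power of 6, reached by the choices of pairs. *)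
apply/eqP; rewrite eq_le le /= -{1}dT mulnC exprM a4 -natrX ler_nat.
exact: leq_phi_kC4.
Qed.
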